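(* Let $f:\mathbb{R}^n\to\mathbb{R}$ be Lipschitz with constant $L$ and bounded below, and let the functions $\Phi_s$ defined below be bounded below (uniformly in $s$) and attain their infima. Let the sequence $\{x_k\}$ be generated by the following algorithm, starting from some $x_1\in\mathbb{R}^n$ and a sequence $\varepsilon_k\to+0$. At step $k$, with current index $s=s(k)$ and $\tilde\Phi_{s,k}(y)=\Phi_s(y)+L_s\|y-x_k\|^2$: (1) compute $\Delta_k=-(\nabla^2\tilde\Phi_{s,k}(x_k))^{-1}\nabla\tilde\Phi_{s,k}(x_k)$; (2) find a nonnegative integer $l_k$ with $\tilde\Phi_{s,k}(x_k+2^{-l_k}\Delta_k)\le\tilde\Phi_{s,k}(x_k)-2^{-2l_k}\frac{L_s}{2}\|\Delta_k\|^2$; (3) set $x_{k+1}=x_k+2^{-l_k}\Delta_k$; (4) as $k$ increases, change $s$ (decreasing $d(D_s)$) so that $\frac{3\|\Delta_k\|}{d(D_s)}<\varepsilon_k$ holds, and repeat. Then every limit point $x^*$ of $\{x_k\}$ is a stationary point of $f$, i.e. $0\in\partial_{CL}f(x^* )$.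
   Context: $\mu$ is Lebesgue measure; integrals are Lebesgue integrals. $D_s=\{v\in\mathbb{R}^n:\|v\|\le r_s\}$ with $r_s\to+0$ as $s\to\infty$, and $d(D_s)$ is its diameter. $\varphi_s(x)=\frac{1}{\mu(D_s)}\int_{D_s}f(x+y)\,dy$ and $\Phi_s(x)=\frac{1}{\mu(D_s)}\int_{D_s}\varphi_s(x+y)\,dy$; $\Phi_s$ is twice continuously differentiable, and $L_s=L/d(D_s)$ is a bound $\|\nabla^2\Phi_s(\cdot)\|\le L_s$ on its Hessian, so that $L_s\|z\|^2\le(\nabla^2\tilde\Phi_{s,k}(x_k)z,z)\le 3L_s\|z\|^2$ for all $z$. $\partial_{CL}f$ denotes the Clarke subdifferential. *)

(* Defs.v *)
From HB Require Import structures.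
From mathcomp Require Import all_boot all_order all_algebra.
From mathcomp Require Import all_classical all_reals all_analysis.
Set Implicit Arguments. Unset Strict Implicit. Unset Printing Implicit Defensive.
Import Order.TTheory GRing.Theory Num.Theory.
Import numFieldNormedType.Exports.
Local Open Scope classical_set_scope.
Local Open Scope ring_scope.

Section Defs.
Variable R : realType.

Definition dotv n (u v : 'rV[R]_n) : R := \sum_(i < n) u ord0 i * v ord0 i.
Definition enorm n (u : 'rV[R]_n) : R := Num.sqrt (dotv u u).

Definition eball n (r : R) : set 'rV[R]_n := [set v | enorm v <= r].

Definition diam n (A : set 'rV[R]_n) : R :=
  sup [set z | exists u v, A u /\ A v /\ z = enorm (u - v)].

(* n-dimensional Lebesgue integral (extended-real valued), written out as
   the iterated one-dimensional Lebesgue integral (Fubini); R^0 is a point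
   with unit mass. *)
Fixpoint lint (n : nat) : ('rV[R]_n -> \bar R) -> \bar R :=
  match n with
  | 0 => fun g => g 0
  | n'.+1 => fun g =>
      (\int[@lebesgue_measure R]_t
         lint (fun y : 'rV[R]_n' => g (row_mx (const_mx t : 'M[R]_1) y)))%E
  end.

Definition lmeas n (A : set 'rV[R]_n) : \bar R := lint (fun y => (\1_A y)%:E).
Definition lint_on n (A : set 'rV[R]_n) (g : 'rV[R]_n -> R) : \bar R :=
  lint (fun y => (\1_A y * g y)%:E).

Definition bavg n (D : set 'rV[R]_n) (g : 'rV[R]_n -> R) (x : 'rV[R]_n) : R :=
  fine (lint_on D (fun y => g (x + y))) / fine (lmeas D).

Definition Phi n (f : 'rV[R]_n -> R) (D : set 'rV[R]_n) : 'rV[R]_n -> R :=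
  bavg D (bavg D f).

Definition evec n (i : 'I_n) : 'rV[R]_n := delta_mx ord0 i.
Definition grad n (F : 'rV[R]_n -> R) (x : 'rV[R]_n) : 'rV[R]_n :=
  \row_i derive F x (evec i).
Definition hess n (F : 'rV[R]_n -> R) (x : 'rV[R]_n) : 'M[R]_n :=
  \matrix_(i, j) derive (fun y => derive F y (evec i)) x (evec j).

Definition C2 n (F : 'rV[R]_n -> R) : Prop :=
  forall i j : 'I_n,
    (forall x, derivable F x (evec i)) /\
    (forall x, derivable (fun y => derive F y (evec i)) x (evec j)) /\
    continuous (fun x => derive (fun y => derive F y (evec i)) x (evec j)).

Definition clarke_dd n (f : 'rV[R]_n -> R) (x v : 'rV[R]_n) : \bar R :=
  ereal_inf [set S | exists d : R, 0 < d /\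
    S = ereal_sup [set z | exists (y : 'rV[R]_n) (t : R),
          enorm (y - x) < d /\ 0 < t < d /\
          z = ((f (y + t *: v) - f y) / t)%:E]].

Definition clarke_subdiff n (f : 'rV[R]_n -> R) (x : 'rV[R]_n) : set 'rV[R]_n :=
  [set xi | forall v, ((dotv xi v)%:E <= clarke_dd f x v)%E].

Definition seq_limit_point n (xs : nat -> 'rV[R]_n) (xstar : 'rV[R]_n) : Prop :=
  forall e : R, 0 < e -> forall N : nat, exists k, (N <= k)%N /\ enorm (xs k - xstar) < e.

End Defs.

Section Defs2.
Variable R : realType.
Definition newton_dir n (F : 'rV[R]_n -> R) (x : 'rV[R]_n) : 'rV[R]_n :=
  - (invmx (hess F x) *m (grad F x)^T)^T.
End Defs2.

(* Main.v *)
Require Import Defs.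
From HB Require Import structures.
From mathcomp Require Import all_boot all_order all_algebra.
From mathcomp Require Import all_classical all_reals all_analysis.
From mathcomp Require Import measurable_realfun ring lra.
Import Order.TTheory GRing.Theory Num.Theory.
Import numFieldNormedType.Exports.
Local Open Scope classical_set_scope.
Local Open Scope ring_scope.

(** With [H = hess Phi_s (x_k)], the Newton system reads
    [grad Phi_s (x_k) = - (H + 2 L_s) Delta_k], so the Hessian bound gives
    [|grad Phi_s (x_k)| <= 3 L_s |Delta_k| < L eps_k], which tends to 0.  If
    Clarke's derivative at [x*] were negative in some direction [v], then
    [f (y + t v) <= f y - t c] near [x*]; averaging twice over small balls
    transfers this inequality to [Phi_s] at the nearby iterates [x_k], hence
    [(grad Phi_s (x_k), v) <= - c], a contradiction for large [k]. *)

(** * The Euclidean norm *)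

(** Nothing is differentiated under the integral sign: ball averages enter only through monotonicity
    and linearity, and the derivatives of Phi_s only through a first-order expansion whose remainder
    the Hessian bound controls. A single index k is fixed, with x_k near x*, the radius small and
    eps_k small; only then does t tend to 0, and c does not depend on k. The factor 3 is 1 + 2: L_s
    from the Hessian of Phi_s and 2 L_s from the quadratic term. As L_s = L / d(D_s), the switching
    rule for s is exactly a bound on 3 L_s |Delta_k|. Since the integral is iterated, its properties
    go by induction on the dimension, and each step requires the slice integral to be measurable and
    integrable in the outer variable. *)

Lemma dotvv_ge0 {R : realType} {n : nat} (u : 'rV[R]_n) : 0 <= dotv u u.
Proof. by apply: sumr_ge0 => i _; rewrite -expr2 sqr_ge0. Qed.

Lemma enorm_ge0 {R : realType} {n : nat} (u : 'rV[R]_n) : 0 <= enorm u.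
Proof. exact: sqrtr_ge0. Qed.

Lemma sqr_enorm {R : realType} {n : nat} (u : 'rV[R]_n) : enorm u ^+ 2 = dotv u u.
Proof. by rewrite sqr_sqrtr // dotvv_ge0. Qed.

Lemma dotvC {R : realType} {n : nat} (u v : 'rV[R]_n) : dotv u v = dotv v u.
Proof. by apply: eq_bigr => i _; rewrite mulrC. Qed.

Lemma dotvDl {R : realType} {n : nat} (u v w : 'rV[R]_n) :
  dotv (u + v) w = dotv u w + dotv v w.
Proof. by rewrite -big_split; apply: eq_bigr => i _; rewrite mxE mulrDl. Qed.

Lemma dotvZl {R : realType} {n : nat} (a : R) (u w : 'rV[R]_n) :
  dotv (a *: u) w = a * dotv u w.
Proof. by rewrite [RHS]mulr_sumr; apply: eq_bigr => i _; rewrite mxE mulrA. Qed.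

Lemma dotvDr {R : realType} {n : nat} (u v w : 'rV[R]_n) :
  dotv w (u + v) = dotv w u + dotv w v.
Proof. by rewrite dotvC dotvDl !(dotvC w). Qed.

Lemma dotvZr {R : realType} {n : nat} (a : R) (u w : 'rV[R]_n) :
  dotv w (a *: u) = a * dotv w u.
Proof. by rewrite dotvC dotvZl (dotvC w). Qed.

Lemma dotv_evec {R : realType} {n : nat} (u : 'rV[R]_n) (i : 'I_n) :
  dotv u (evec R i) = u ord0 i.
Proof.
rewrite /dotv (bigD1 i) //= big1 ?addr0 => [|j /negPf ji].
  by rewrite mxE !eqxx mulr1.
by rewrite mxE ji andbF mulr0.
Qed.

(** With a = |u|^2, b = |v|^2 and p = (u, v), the squared norm of b u - p v equals b (a b - p^2);
    dividing by b leaves the case v = 0 apart. *)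
Lemma dotv_sqr_le {R : realType} {n : nat} (u v : 'rV[R]_n) :
  dotv u v ^+ 2 <= dotv u u * dotv v v.
Proof.
have := dotvv_ge0 (dotv v v *: u - dotv u v *: v).
rewrite -scaleNr !(dotvDl, dotvDr, dotvZl, dotvZr) (dotvC v u).
set a := dotv u u; set b := dotv v v; set p := dotv u v.
rewrite [X in 0 <= X](_ : _ = b * (a * b - p ^+ 2)); last by ring.
have [b0|b0] := eqVneq b 0.
  have v0 i : v ord0 i = 0.
    apply/eqP; rewrite -sqrf_eq0 expr2.
    move/eqP: b0; rewrite /b psumr_eq0 => [/allP/(_ i)|j _].
      by rewrite mem_index_enum => /(_ isT).
    by rewrite -expr2 sqr_ge0.
  by rewrite b0 mulr0 /p /dotv big1 ?expr0n //= => i _; rewrite v0 mulr0.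
have bp : 0 < b by rewrite lt_neqAle eq_sym b0 dotvv_ge0.
by rewrite pmulr_rge0 // subr_ge0.
Qed.

Lemma dotv_le {R : realType} {n : nat} (u v : 'rV[R]_n) :
  `|dotv u v| <= enorm u * enorm v.
Proof.
rewrite -(@ler_pXn2r _ 2) ?nnegrE ?mulr_ge0 ?enorm_ge0 //.
by rewrite -normrX ger0_norm ?sqr_ge0 // exprMn !sqr_enorm dotv_sqr_le.
Qed.

Lemma enormD {R : realType} {n : nat} (u v : 'rV[R]_n) :
  enorm (u + v) <= enorm u + enorm v.
Proof.
rewrite -(@ler_pXn2r _ 2) ?nnegrE ?addr_ge0 ?enorm_ge0 //.
rewrite sqrrD !sqr_enorm dotvDl !dotvDr (dotvC v u).
have := le_trans (ler_norm _) (dotv_le u v); rewrite mulr2n; lra.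
Qed.

Lemma enormZ {R : realType} {n : nat} (a : R) (u : 'rV[R]_n) :
  enorm (a *: u) = `|a| * enorm u.
Proof.
by rewrite /enorm dotvZl dotvZr mulrA -expr2 sqrtrM ?sqr_ge0 // sqrtr_sqr.
Qed.

Lemma enormN {R : realType} {n : nat} (u : 'rV[R]_n) : enorm (- u) = enorm u.
Proof. by rewrite -scaleN1r enormZ normrN1 mul1r. Qed.

Lemma coord_le_enorm {R : realType} {n : nat} (u : 'rV[R]_n) (i : 'I_n) :
  `|u ord0 i| <= enorm u.
Proof.
rewrite -(@ler_pXn2r _ 2) ?nnegrE ?enorm_ge0 // sqr_enorm.
rewrite -normrX ger0_norm ?sqr_ge0 // /dotv (bigD1 i) //= -expr2 lerDl.
by apply: sumr_ge0 => j _; rewrite -expr2 sqr_ge0.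
Qed.

Lemma enorm0_eq0 {R : realType} {n : nat} (u : 'rV[R]_n) : enorm u = 0 -> u = 0.
Proof.
move=> u0; apply/rowP => i; apply/eqP; rewrite mxE -normr_le0 -u0.
exact: coord_le_enorm.
Qed.

Lemma enorm0 {R : realType} {n : nat} : enorm (0 : 'rV[R]_n) = 0.
Proof. by rewrite -(scale0r 0) enormZ normr0 mul0r. Qed.

Lemma enorm_le_coord {R : realType} {n : nat} (u : 'rV[R]_n) (e : R) :
  0 <= e -> (forall i, `|u ord0 i| <= e) -> enorm u <= n%:R * e.
Proof.
move=> e0 ue; rewrite -(@ler_pXn2r _ 2) ?nnegrE ?mulr_ge0 ?enorm_ge0 //.
rewrite sqr_enorm (@le_trans _ _ (\sum_(i < n) e ^+ 2)) //.
  apply: ler_sum => i _; rewrite -expr2 -[_ ^+ 2]ger0_norm ?sqr_ge0 // normrX.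
  by rewrite ler_pXn2r ?nnegrE.
rewrite sumr_const card_ord exprMn -[leLHS]mulr_natl ler_wpM2r ?sqr_ge0 //.
by rewrite -natrX ler_nat; case: (n) => // m; rewrite leq_pmulr.
Qed.

Lemma enorm_evec {R : realType} {n : nat} (i : 'I_n) : enorm (evec R i) = 1.
Proof. by rewrite /enorm dotv_evec mxE !eqxx sqrtr1. Qed.

Lemma rat_row_dense {R : realType} {n : nat} (u : 'rV[R]_n) (e : R) : 0 < e ->
  exists q : 'rV[rat]_n, enorm (u - map_mx ratr q) < e.
Proof.
(* Dividing by n + 1 keeps [d] defined for n = 0 and makes n d < e strict. *)
move=> e0; set d := e / n.+1%:R.
have d0 : 0 < d by rewrite divr_gt0.
have [/= q qP] : {q : 'I_n -> rat & forall i, `|u ord0 i - ratr (q i)| <= d}.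
  apply: (@choice _ _ (fun i q => `|u ord0 i - ratr q| <= d)) => i.
  have [q] := @rat_in_itvoo R (u ord0 i - d) (u ord0 i + d) ltac:(lra).
  by rewrite in_itv /= => /andP[h1 h2]; exists q; rewrite ler_norml; apply/andP; split; lra.
exists (\row_i q i); apply: (@le_lt_trans _ _ (n%:R * d)).
  by apply: enorm_le_coord => [|i]; [exact: ltW | rewrite !mxE; exact: qP].
by rewrite mulrCA gtr_pMr // ltr_pdivrMr // mul1r ltr_nat.
Qed.

Lemma enorm_le_diam_eball {R : realType} {n : nat} (r : R) (u : 'rV[R]_n) :
  0 <= r -> enorm u <= r -> enorm u <= diam (eball r : set 'rV[R]_n).
Proof.
move=> r0 ur; apply: ub_le_sup; last first.
  by exists u, 0; rewrite /eball /= enorm0 subr0.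
exists (r + r) => _ [v [w [vr [wr ->]]]].
by rewrite (le_trans (enormD _ _)) // enormN lerD.
Qed.

(** * The iterated Lebesgue integral *)

Definition coord_measurable {R : realType} {n : nat} {d : measure_display}
    {S : measurableType d} (h : S -> 'rV[R]_n) : Prop :=
  forall i, measurable_fun setT (fun s => h s ord0 i).

(* Row vectors carry no sigma-algebra here, so Borel measurability is tested
   along all maps with measurable coordinates. *)
Definition borel_row {R : realType} {n : nat} (g : 'rV[R]_n -> R) : Prop :=
  forall (d : measure_display) (S : measurableType d) (h : S -> 'rV[R]_n),
    coord_measurable h -> measurable_fun setT (fun s => g (h s)).

(** The freedom in the test space [S] lets the induction on the dimension move a coordinate of the
    row into the parameter. *)
Definition jointly_measurable {R : realType} {n : nat} {d : measure_display}
    {T : measurableType d} (G : T -> 'rV[R]_n -> \bar R) : Prop :=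
  forall (d' : measure_display) (S : measurableType d') (a : S -> T)
         (h : S -> 'rV[R]_n),
    measurable_fun setT a -> coord_measurable h ->
    measurable_fun setT (fun s => G (a s) (h s)).

(** Convertible to the row inside [lint], so unfolding one dimension yields it directly. *)
Definition cons_row {R : realType} {n : nat} (t : R) (y : 'rV[R]_n) : 'rV[R]_n.+1 :=
  row_mx (const_mx t : 'M[R]_1) y.

Lemma cons_rowE {R : realType} {n : nat} (t : R) (y : 'rV[R]_n) (i : 'I_n.+1) :
  cons_row t y ord0 i = oapp (y ord0) t (unlift ord0 i).
Proof.
rewrite /cons_row mxE; case: splitP => [j|j] ij.
  by rewrite (_ : i = ord0) ?unlift_none ?mxE //; apply: ord_inj; rewrite [LHS]ij (ord1 j).
by rewrite (_ : i = lift ord0 j) ?liftK //; apply: ord_inj; rewrite [LHS]ij.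
Qed.

Lemma coord_measurable_cons {R : realType} {n : nat} {d : measure_display}
    {S : measurableType d} (a : S -> R) (h : S -> 'rV[R]_n) :
  measurable_fun setT a -> coord_measurable h ->
  coord_measurable (fun s => cons_row (a s) (h s)).
Proof.
move=> ma mh i; under eq_fun do rewrite cons_rowE.
by case: unliftP => [j _|_] /=; [exact: mh | exact: ma].
Qed.

(** The outer integration variable joins the parameter in a product space; the induction hypothesis
    makes the inner integral measurable there, and Tonelli integrates the variable out. *)
Lemma measurable_lint {R : realType} {n : nat} {d : measure_display}
    {T : measurableType d} (G : T -> 'rV[R]_n -> \bar R) :
  jointly_measurable G -> measurable_fun setT (fun t => lint (G t)).
Proof.
elim: n d T G => [|n IH] d T G mG /=.
  by apply: (mG _ _ id (fun=> 0)) => // i; apply: measurable_cst.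
pose g (p : T * measurableTypeR R) : \bar R := lint (fun y => G p.1 (cons_row p.2 y)).
have mg : measurable_fun setT g.
  apply: IH => d' S a h ma mh.
  apply: (mG _ _ (fun s => (a s).1) (fun s => cons_row (a s).2 (h s))).
    exact: measurableT_comp.
  by apply: coord_measurable_cons => //; exact: measurableT_comp.
(* Tonelli applies to nonnegative functions, hence the split into positive and negative parts. *)
under eq_fun do rewrite integralE.
apply: emeasurable_funB.
- rewrite (_ : (fun x => _) = fubini_F lebesgue_measure g^\+%E).
    exact: (measurable_fun_fubini_tonelli_F _ (measurable_funepos mg) (funepos_ge0 g)).
  by apply/funext => t; apply: eq_integral => u _; rewrite !funeposE.
- rewrite (_ : (fun x => _) = fubini_F lebesgue_measure g^\-%E).
    exact: (measurable_fun_fubini_tonelli_F _ (measurable_funeneg mg) (funeneg_ge0 g)).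
  by apply/funext => t; apply: eq_integral => u _; rewrite !funenegE.
Qed.

(** * Measurability of norms, Lipschitz functions, boxes and balls *)

Lemma measurable_enorm {R : realType} {n : nat} {d : measure_display}
    {S : measurableType d} (h : S -> 'rV[R]_n) :
  coord_measurable h -> measurable_fun setT (fun s => enorm (h s)).
Proof.
move=> mh; apply: (@measurableT_comp _ _ _ _ _ _ (@Num.sqrt R)).
  by apply: continuous_measurable_fun => x; exact: sqrt_continuous.
by apply: measurable_sum => i; exact: measurable_funM.
Qed.

Lemma measurable_set_lt {R : realType} {d : measure_display} {S : measurableType d}
    (F : S -> R) (c : R) :
  measurable_fun setT F -> measurable [set s | F s < c].
Proof.
move=> mF; rewrite (_ : [set _ | _] = setT `&` F @^-1` `]-oo, c[).
  exact: mF.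
by apply/seteqP; split => s /=; rewrite in_itv /= => // -[].
Qed.

Lemma measurable_set_le {R : realType} {d : measure_display} {S : measurableType d}
    (F : S -> R) (c : R) :
  measurable_fun setT F -> measurable [set s | F s <= c].
Proof.
move=> mF; rewrite (_ : [set _ | _] = setT `&` F @^-1` `]-oo, c]).
  exact: mF.
by apply/seteqP; split => s /=; rewrite in_itv /= => // -[].
Qed.

(** A Lipschitz function is the infimum over rational points q of f(q) + L |u - q|, so each strict
    sublevel set is a countable union of sets measurable through the norm. *)
Lemma lipschitz_borel_row {R : realType} {n : nat} (f : 'rV[R]_n -> R) (L : R) :
  0 <= L -> (forall u v, `|f u - f v| <= L * enorm (u - v)) -> borel_row f.
Proof.
move=> L0 fL d S h mh.
apply: (measurability _ (RGenInftyO.measurableE R)).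
move=> _ [_ [a ->] <-].
rewrite setTI (_ : _ @^-1` _ = \bigcup_(q : 'rV[rat]_n)
    [set s | f (map_mx ratr q) + L * enorm (h s - map_mx ratr q) < a]).
  apply: countable_bigcupT_measurable => // q.
  apply: measurable_set_lt; apply: measurable_funD => //; apply: measurable_funM => //.
  apply: measurable_enorm => i; under eq_fun do rewrite mxE.
  exact: measurable_funD.
apply/seteqP; split => s /=; rewrite in_itv /=.
  (* If z = |u - q| is below this bound, then f(q) + L z <= f(u) + 2 L z < a; the added 1 covers L =
     0. *)
  move=> fa; have e0 : 0 < (a - f (h s)) / (2 * L + 1) by apply: divr_gt0; lra.
  have [q qe] := rat_row_dense (h s) _ e0; exists q => //=.
  have := fL (h s) (map_mx ratr q); rewrite ler_norml => /andP[+ _].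
  move: qe; rewrite ltr_pdivlMr; last by lra.
  have := enorm_ge0 (h s - map_mx ratr q).
  set z := enorm _; nra.
move=> [q _ /=]; have := fL (h s) (map_mx ratr q); rewrite ler_norml => /andP[_ +].
lra.
Qed.

Definition box {R : realType} {n : nat} (rho : R) : set 'rV[R]_n :=
  [set y | forall i, `|y ord0 i| <= rho].

Lemma borel_row_indic {R : realType} {n : nat} (A : set 'rV[R]_n) :
  (forall (d : measure_display) (S : measurableType d) (h : S -> 'rV[R]_n),
    coord_measurable h -> measurable (h @^-1` A)) ->
  borel_row (\1_A : 'rV[R]_n -> R).
Proof.
move=> mA d S h mh; rewrite (_ : (fun s => _) = \1_(h @^-1` A)) //.
exact: measurable_indic (mA _ _ _ mh).
Qed.

Lemma borel_row_indic_box {R : realType} {n : nat} (rho : R) :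
  borel_row (\1_(box rho) : 'rV[R]_n -> R).
Proof.
apply: borel_row_indic => d S h mh.
rewrite (_ : _ @^-1` _ = \bigcap_(i in [set: 'I_n]) [set s | `|h s ord0 i| <= rho]).
  apply: fin_bigcap_measurable => // i _.
  by apply: measurable_set_le; exact: measurableT_comp.
by apply/seteqP; split => s H i; [move=> _; exact: H | exact: H].
Qed.

Lemma borel_row_indic_eball {R : realType} {n : nat} (r : R) :
  borel_row (\1_(eball r) : 'rV[R]_n -> R).
Proof.
apply: borel_row_indic => d S h mh; apply: (measurable_set_le (fun s => enorm (h s))).
exact: measurable_enorm.
Qed.

(* On such functions the iterated integral is linear and monotone. *)
Definition tame {R : realType} {n : nat} (M rho : R) (g : 'rV[R]_n -> R) : Prop :=
  [/\ borel_row g, forall y, `|g y| <= M &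
      forall (y : 'rV[R]_n) i, rho < `|y ord0 i| -> g y = 0].

(** Slices at |t| > rho vanish; recording this as an indicator in the bound makes it integrable in
    t. *)
Lemma tame_slice {R : realType} {n : nat} (M rho : R) (g : 'rV[R]_n.+1 -> R) (t : R) :
  tame M rho g -> tame (M * \1_`[- rho, rho] t) rho (fun y => g (cons_row t y)).
Proof.
move=> [mg Mg zg]; split => [d S h mh|y|y i yi].
- by apply: (mg _ _ (fun s => cons_row t (h s))); exact: coord_measurable_cons.
- rewrite indicE mem_setE in_itv /= -ler_norml; case: (leP `|t| rho) => [_|rt].
    by rewrite mulr1.
  by rewrite mulr0 (zg _ ord0) ?normr0 // cons_rowE unlift_none.
- by apply: (zg _ (lift ord0 i)); rewrite cons_rowE liftK.
Qed.

Lemma lebesgue_measure_sym_itv {R : realType} (rho : R) : 0 <= rho ->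
  lebesgue_measure (`[- rho, rho]%classic : set R) = (2 * rho)%:E.
Proof.
move=> rho0; rewrite lebesgue_measure_itv /= lte_fin.
case: ltP => [_|]; first by rewrite -EFinB; congr (_%:E); ring.
by move=> h; congr (_%:E); lra.
Qed.

Lemma integrable_slice_bound {R : realType} (M rho : R) :
  lebesgue_measure.-integrable setT (fun t : R => (M * \1_`[- rho, rho] t)%:E).
Proof.
exact: (integrableZl measurableT M (integrable_indic_itv (- rho) rho true false)).
Qed.

Lemma measurable_lint_slice {R : realType} {n : nat} (g : 'rV[R]_n.+1 -> R) :
  borel_row g ->
  measurable_fun setT (fun t : R => lint (fun y => (g (cons_row t y))%:E)).
Proof.
move=> mg; apply: measurable_lint => d S a h ma mh.
by apply/measurable_EFinP; apply: mg; exact: coord_measurable_cons.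
Qed.

Lemma lint_bound {R : realType} {n : nat} (M rho : R) (g : 'rV[R]_n -> R) :
  0 <= rho -> tame M rho g ->
  (`|lint (fun y => (g y)%:E)| <= (M * (2 * rho) ^+ n)%:E)%E.
Proof.
move=> rho0; elim: n M g => [|n IH] M g tg /=.
  by case: tg => _ Mg _; rewrite expr0 mulr1 lee_fin.
apply: (le_trans (le_abse_integral _ measurableT _)).
  by apply: measurable_lint_slice; case: tg.
have <- : (\int[lebesgue_measure]_(t in [set: R]) ((M * (2 * rho) ^+ n)%:E *
    (\1_`[- rho, rho] t)%:E) = (M * (2 * rho) ^+ n.+1)%:E)%E.
  rewrite (integralZl measurableT (integrable_indic_itv (- rho) rho true false)).
  rewrite integral_indic // setIT [X in (_ * X)%E]lebesgue_measure_sym_itv //.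
  by rewrite -EFinM exprSr !mulrA.
apply: ge0_le_integral => //.
- by apply: measurableT_comp => //; apply: measurable_lint_slice; case: tg.
- by apply: measurable_funeM; apply/measurable_EFinP; exact: measurable_indic.
- move=> t _; rewrite -EFinM mulrAC; exact: (IH _ _ (tame_slice _ _ _ t tg)).
Qed.

(** [bavg] applies [fine], which sends infinite values to 0; finiteness lets inequalities pass
    through it. *)
Lemma lint_fin_num {R : realType} {n : nat} (M rho : R) (g : 'rV[R]_n -> R) :
  0 <= rho -> tame M rho g -> lint (fun y => (g y)%:E) \is a fin_num.
Proof.
by move=> rho0 tg; rewrite fin_num_abs (le_lt_trans (lint_bound _ _ _ rho0 tg)) ?ltry.
Qed.

Lemma integrable_lint_slice {R : realType} {n : nat} (M rho : R)
    (g : 'rV[R]_n.+1 -> R) : 0 <= rho -> tame M rho g ->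
  lebesgue_measure.-integrable setT
    (fun t : R => lint (fun y => (g (cons_row t y))%:E)).
Proof.
move=> rho0 tg.
apply: (le_integrable measurableT _ _
          (integrable_slice_bound (M * (2 * rho) ^+ n) rho)).
  by apply: measurable_lint_slice; case: tg.
move=> t _; have h := lint_bound _ _ _ rho0 (tame_slice _ _ _ t tg).
apply: (le_trans h); rewrite abse_EFin lee_fin mulrAC; exact: ler_norm.
Qed.

Lemma tame_lin {R : realType} {n : nat} (M1 M2 rho a : R) (g1 g2 : 'rV[R]_n -> R) :
  tame M1 rho g1 -> tame M2 rho g2 ->
  tame (M1 + `|a| * M2) rho (fun y => g1 y + a * g2 y).
Proof.
move=> [m1 b1 z1] [m2 b2 z2]; split => [d S h mh|y|y i yi].
- by apply: measurable_funD; [exact: m1|apply: measurable_funM => //; exact: m2].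
- by rewrite (le_trans (ler_normD _ _)) // lerD // normrM ler_wpM2l.
- by rewrite (z1 _ _ yi) (z2 _ _ yi) mulr0 addr0.
Qed.

(** Splitting the outer integral requires integrable slices, which tameness provides. The
    coefficient [a] later carries an additive constant, as a multiple of the indicator of the
    ball. *)
Lemma lint_lin {R : realType} {n : nat} (M1 M2 rho a : R) (g1 g2 : 'rV[R]_n -> R) :
  0 <= rho -> tame M1 rho g1 -> tame M2 rho g2 ->
  (lint (fun y => (g1 y + a * g2 y)%:E) =
   lint (fun y => (g1 y)%:E) + a%:E * lint (fun y => (g2 y)%:E))%E.
Proof.
move=> rho0; elim: n M1 M2 g1 g2 => [|n IH] M1 M2 g1 g2 t1 t2 //=.
transitivity (\int[lebesgue_measure]_(t in [set: R])
   (lint (fun y => (g1 (cons_row t y))%:E) +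
    a%:E * lint (fun y => (g2 (cons_row t y))%:E)))%E.
  apply: eq_integral => t _.
  exact: (IH _ _ _ _ (tame_slice _ _ _ t t1) (tame_slice _ _ _ t t2)).
have i1 := integrable_lint_slice _ _ _ rho0 t1.
have i2 := integrable_lint_slice _ _ _ rho0 t2.
by rewrite (integralD measurableT i1 (integrableZl measurableT a i2)) integralZl.
Qed.

Lemma le_lint {R : realType} {n : nat} (M1 M2 rho : R) (g1 g2 : 'rV[R]_n -> R) :
  0 <= rho -> tame M1 rho g1 -> tame M2 rho g2 -> (forall y, g1 y <= g2 y) ->
  (lint (fun y => (g1 y)%:E) <= lint (fun y => (g2 y)%:E))%E.
Proof.
move=> rho0; elim: n M1 M2 g1 g2 => [|n IH] M1 M2 g1 g2 t1 t2 le12 /=.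
  by rewrite lee_fin.
apply: (le_integral measurableT (integrable_lint_slice _ _ _ rho0 t1)
                                (integrable_lint_slice _ _ _ rho0 t2)) => t _.
exact: (IH _ _ _ _ (tame_slice _ _ _ t t1) (tame_slice _ _ _ t t2)).
Qed.

(** * Volumes of boxes and balls *)

Lemma tame_indic {R : realType} {n : nat} (rho : R) (A : set 'rV[R]_n) :
  borel_row (\1_A : 'rV[R]_n -> R) -> A `<=` box rho -> tame 1 rho (\1_A).
Proof.
move=> mA AB; split => // [y|y i yi].
  by rewrite indicE; case: (_ \in _); rewrite ?normr1 ?normr0.
rewrite indicE (_ : _ \in _ = false) //; apply/negbTE/negP; rewrite inE => /AB /(_ i).
by rewrite leNgt yi.
Qed.

Lemma lint0 {R : realType} (n : nat) : lint (fun _ : 'rV[R]_n => 0%E) = 0%E.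
Proof.
elim: n => //= n IH; rewrite -[RHS](integral0 lebesgue_measure setT).
by apply: eq_integral => t _; exact: IH.
Qed.

(** The indicator of a box factors over coordinates, so each integration contributes 2 rho. *)
Lemma lint_box {R : realType} {n : nat} (rho : R) : 0 <= rho ->
  lint (fun y : 'rV[R]_n => (\1_(box rho) y)%:E) = ((2 * rho) ^+ n)%:E.
Proof.
move=> rho0; elim: n => [|n IH] /=.
  by rewrite indicE (_ : _ \in _) // inE => -[].
transitivity (\int[lebesgue_measure]_(t in [set: R])
    (((2 * rho) ^+ n)%:E * (\1_`[- rho, rho] t)%:E))%E; last first.
  rewrite (integralZl measurableT (integrable_indic_itv (- rho) rho true false)).
  rewrite integral_indic // setIT [X in (_ * X)%E]lebesgue_measure_sym_itv //.
  by rewrite -EFinM exprSr.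
apply: eq_integral => t _; rewrite -IH.
have boxE (y : 'rV[R]_n) :
    \1_(box rho) (cons_row t y) = \1_`[- rho, rho] t * \1_(box rho) y :> R.
  rewrite !indicE -natrM mulnb; congr (_%:R); congr nat_of_bool.
  rewrite mem_setE in_itv /= -ler_norml; apply/idP/andP.
    rewrite !inE => H; split; first by have := H ord0; rewrite cons_rowE unlift_none.
    by move=> i; have := H (lift ord0 i); rewrite cons_rowE liftK.
  by rewrite !inE => -[H1 H2] i; rewrite cons_rowE; case: unliftP => [j _|_] /=.
under [in LHS]eq_fun do rewrite boxE.
rewrite indicE; case: (_ \in _).
  by rewrite mule1; congr lint; apply: funext => y; rewrite mul1r.
by rewrite mule0 -(lint0 n); congr lint; apply: funext => y; rewrite mul0r.
Qed.

Lemma tame_indic_eball {R : realType} {n : nat} (r : R) :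
  tame 1 r (\1_(eball r) : 'rV[R]_n -> R).
Proof.
apply: tame_indic; first exact: borel_row_indic_eball.
by move=> y yr i; exact: le_trans (coord_le_enorm _ _) yr.
Qed.

Lemma tame_indic_box {R : realType} {n : nat} (rho : R) :
  tame 1 rho (\1_(box rho) : 'rV[R]_n -> R).
Proof. by apply: tame_indic; first exact: borel_row_indic_box. Qed.

Lemma tame_le_radius {R : realType} {n : nat} (M rho rho' : R) (g : 'rV[R]_n -> R) :
  rho <= rho' -> tame M rho g -> tame M rho' g.
Proof. by move=> rr [mg Mg zg]; split => // y i /(le_lt_trans rr)/zg. Qed.

Lemma lmeas_eball_gt0 {R : realType} {n : nat} (r : R) : 0 < r ->
  (0 < lmeas (eball r : set 'rV[R]_n))%E.
Proof.
(* The box of half-side r / (n + 1) lies in the ball, and its volume is explicit. *)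
move=> r0; set rho := r / n.+1%:R.
have rho0 : 0 < rho by rewrite divr_gt0.
have rho_r : n%:R * rho <= r.
  by rewrite mulrCA ger_pMr // ler_pdivrMr // mul1r ler_nat.
have rho_le : rho <= r by rewrite ler_pdivrMr // ler_peMr ?ler1n // ltW.
apply: (@lt_le_trans _ _ ((2 * rho) ^+ n)%:E).
  by rewrite lte_fin exprn_gt0 // mulr_gt0.
rewrite -(lint_box _ (ltW rho0)).
apply: (le_lint _ _ _ _ _ (ltW r0) (tame_le_radius _ _ _ _ rho_le (tame_indic_box rho))
                  (tame_indic_eball r)) => y.
rewrite !indicE; case: (boolP (y \in box rho)) => [|_]; last by rewrite ler_nat.
rewrite inE => yb; rewrite (mem_set (_ : eball r y)) //.
by apply: le_trans rho_r; apply: enorm_le_coord => //; exact: ltW.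
Qed.

Lemma lmeas_eball_fin_num {R : realType} {n : nat} (r : R) : 0 <= r ->
  lmeas (eball r : set 'rV[R]_n) \is a fin_num.
Proof. by move=> r0; exact: (lint_fin_num _ _ _ r0 (tame_indic_eball r)). Qed.

(** * Averages over balls *)

Lemma tame_lipschitz_eball {R : realType} {n : nat} (g : 'rV[R]_n -> R) (L r : R)
    (u : 'rV[R]_n) :
  0 <= L -> (forall u v, `|g u - g v| <= L * enorm (u - v)) -> 0 <= r ->
  tame (`|g u| + L * r) r (fun w => \1_(eball r) w * g (u + w)).
Proof.
move=> L0 gL r0; have [mI _ zI] := @tame_indic_eball R n r.
split => [d S h mh|w|w i wi]; last by rewrite (zI _ _ wi) mul0r.
  apply: measurable_funM; first exact: mI.
  apply: (lipschitz_borel_row _ _ L0 gL _ _ (fun s => u + h s)) => i.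
  by under eq_fun do rewrite mxE; exact: measurable_funD.
rewrite indicE; case: (boolP (w \in _)) => [|_]; last first.
  by rewrite mul0r normr0 addr_ge0 // mulr_ge0.
rewrite inE mul1r => wr; have := gL (u + w) u; rewrite addrAC subrr add0r => h.
rewrite -[X in `|X|](subrK (g u)) addrC (le_trans (ler_normD _ _)) //.
by rewrite lerD2l (le_trans h) // ler_wpM2l.
Qed.

(** The constant c is c times the average of the indicator of the ball, so the claim reduces to a
    pointwise comparison of integrands. *)
Lemma le_bavg_eball {R : realType} {n : nat} (g : 'rV[R]_n -> R) (L r c : R)
    (u v : 'rV[R]_n) :
  0 <= L -> (forall u v, `|g u - g v| <= L * enorm (u - v)) -> 0 < r ->
  (forall w, enorm w <= r -> g (u + w) <= g (v + w) + c) ->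
  bavg (eball r) g u <= bavg (eball r) g v + c.
Proof.
move=> L0 gL r0 guv; have r0' := ltW r0.
have mu0 := @lmeas_eball_gt0 R n r r0; have muf := @lmeas_eball_fin_num R n r r0'.
have tu := tame_lipschitz_eball g L r u L0 gL r0'.
have tv := tame_lipschitz_eball g L r v L0 gL r0'.
have tI := @tame_indic_eball R n r.
have fmu0 : 0 < fine (lmeas (eball r : set 'rV[R]_n)).
  by rewrite fine_gt0 // mu0 ltey_eq muf.
rewrite /bavg ler_pdivrMr // mulrDl divfK ?gt_eqF //.
have fu := lint_fin_num _ _ _ r0' tu; have fv := lint_fin_num _ _ _ r0' tv.
rewrite -lee_fin EFinD EFinM !fineK //.
rewrite /lint_on /lmeas -(lint_lin _ _ _ _ _ _ r0' tv tI).
apply: (le_lint _ _ _ _ _ r0' tu (tame_lin _ _ _ c _ _ tv tI)) => w.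
rewrite indicE; case: (boolP (w \in _)) => [|_]; last by rewrite !(mul0r, mulr0) addr0.
by rewrite inE !mul1r mulr1 => /guv.
Qed.

(** Allows a second averaging: the comparison of averages asks for a Lipschitz integrand. *)
Lemma lipschitz_bavg_eball {R : realType} {n : nat} (g : 'rV[R]_n -> R) (L r : R) :
  0 <= L -> (forall u v, `|g u - g v| <= L * enorm (u - v)) -> 0 < r ->
  forall u v, `|bavg (eball r) g u - bavg (eball r) g v| <= L * enorm (u - v).
Proof.
move=> L0 gL r0 u v.
have H u' v' : bavg (eball r) g u' <= bavg (eball r) g v' + L * enorm (u' - v').
  apply: (le_bavg_eball _ _ _ _ _ _ L0 gL r0) => w _; have := gL (u' + w) (v' + w).
  rewrite opprD addrACA subrr addr0 ler_norml => /andP[_]; lra.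
rewrite ler_norml; have := H v u; rewrite -enormN opprB; have := H u v.
by move=> h1 h2; apply/andP; split; lra.
Qed.

(** Each averaging moves the point by at most r, whence the margin 2 r. *)
Lemma Phi_eball_decr {R : realType} {n : nat} (f : 'rV[R]_n -> R) (L r d c : R)
    (x0 v y : 'rV[R]_n) (t : R) :
  0 <= L -> (forall u v, `|f u - f v| <= L * enorm (u - v)) -> 0 < r ->
  (forall z, enorm (z - x0) < d -> f (z + t *: v) <= f z + c) ->
  enorm (y - x0) + 2 * r < d ->
  Phi f (eball r) (y + t *: v) <= Phi f (eball r) y + c.
Proof.
move=> L0 fL r0 fd yd.
have gL := lipschitz_bavg_eball _ _ _ L0 fL r0.
apply: (le_bavg_eball _ _ _ _ _ _ L0 gL r0) => w wr.
apply: (le_bavg_eball _ _ _ _ _ _ L0 fL r0) => w' wr'.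
rewrite (_ : y + t *: v + w + w' = y + w + w' + t *: v); last first.
  by rewrite -!addrA; congr (_ + _); rewrite addrC addrA.
apply: fd; rewrite (_ : y + w + w' - x0 = y - x0 + (w + w')); last first.
  by rewrite -!addrA; congr (_ + _); rewrite addrA addrC.
have := enormD (y - x0) (w + w'); have := enormD w w'; lra.
Qed.

(** * First-order expansions from partial derivatives *)

(* The second-order term [c] makes this cover linear and quadratic functions. *)
Lemma is_derive_quotient {R : realType} {n : nat} (F : 'rV[R]_n -> R)
    (x v : 'rV[R]_n) (l c : R) :
  (forall h, F (x + h *: v) = F x + h * (l + h * c)) -> is_derive x v F l.
Proof.
move=> FE.
have H : (fun h => h^-1 *: ((F \o shift x) (h *: v) - F x)) @ 0^' --> l.
  have : (fun h : R => l + h * c) @ 0^' --> l.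
    rewrite -[X in _ --> X]addr0 -[X in _ + X](mul0r c).
    apply: cvg_within_filter; apply: cvgD; first exact: cvg_cst.
    by apply: cvgM; [exact: cvg_id | exact: cvg_cst].
  apply: cvg_trans; apply: near_eq_cvg; near=> h.
  have h0 : h != 0 by near: h; exact: nbhs_dnbhs_neq.
  by rewrite /= [h *: v + x]addrC FE addrAC subrr add0r /GRing.scale /= mulKf.
by apply: DeriveDef; [exact: (cvgP _ H) | exact: (cvg_lim _ H)].
Unshelve. all: by end_near.
Qed.

Lemma is_derive_line {R : realType} {n : nat} (F : 'rV[R]_n -> R)
    (a e : 'rV[R]_n) (t : R) : derivable F (a + t *: e) e ->
  is_derive t (1 : R) (fun h => F (a + h *: e)) (derive F (a + t *: e) e).
Proof.
move=> dF.
have E : (fun h : R => h^-1 *: (((fun h => F (a + h *: e)) \o shift t) (h *: 1)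
                      - F (a + t *: e))) =
         (fun h => h^-1 *: ((F \o shift (a + t *: e)) (h *: e) - F (a + t *: e))).
  apply/funext => h /=; congr (_ *: (F _ - _)).
  by rewrite [h *: 1]mulr1 scalerDl addrCA.
by apply: DeriveDef; rewrite /derivable /derive E.
Qed.

Lemma mvt_line {R : realType} {n : nat} (F : 'rV[R]_n -> R) (a e : 'rV[R]_n) (t : R) :
  (forall y, derivable F y e) ->
  exists2 z, `|z| <= `|t| & F (a + t *: e) - F a = t * derive F (a + z *: e) e.
Proof.
move=> dF.
have id (z : R) : is_derive z (1 : R) (fun h => F (a + h *: e)) (derive F (a + z *: e) e).
  exact: is_derive_line.
have cF b c : {within `[b, c], continuous (fun h => F (a + h *: e))}.
  apply: continuous_subspaceT => z; apply: differentiable_continuous.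
  by apply/derivable1_diffP; case: (id z).
case: (leP 0 t) => t0.
  have [z] := MVT_segment t0 (fun z _ => id z) (cF 0 t).
  rewrite in_itv /= scale0r addr0 subr0 mulrC => /andP[z0 zt] ->.
  by exists z => //; rewrite !ger0_norm.
have [z] := MVT_segment (ltW t0) (fun z _ => id z) (cF t 0).
rewrite in_itv /= scale0r addr0 sub0r => /andP[tz z0] E.
exists z; first by rewrite !ler0_norm ?lerN2 // ltW.
by rewrite -opprB E mulrN opprK mulrC.
Qed.

(** The segment is replaced by a path along the axes, which stays in the box of half-side K; the
    one-variable mean value theorem bounds each of its n legs by K B. Only partial derivatives are
    needed. *)
Lemma le_partials_box {R : realType} {n : nat} (h : 'rV[R]_n -> R) (x v : 'rV[R]_n)
    (B K : R) :
  (forall y i, derivable h y (evec R i)) ->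
  (forall i, `|v ord0 i| <= K) ->
  (forall (w : 'rV[R]_n) i, (forall j, `|w ord0 j| <= K) -> `|derive h (x + w) (evec R i)| <= B) ->
  `|h (x + v) - h x| <= n%:R * (K * B).
Proof.
move=> dh vK hB.
(* Vertices of the path: the first m coordinates of v, then zeros. *)
pose P m : 'rV[R]_n := \row_i (if (i < m)%N then v ord0 i else 0).
have PK m i : `|P m ord0 i| <= K.
  by rewrite mxE; case: ifP => // _; rewrite normr0 (le_trans _ (vK i)).
have Pn : P n = v by apply/rowP => i; rewrite mxE ltn_ord.
rewrite -Pn; suff : forall m, (m <= n)%N -> `|h (x + P m) - h x| <= m%:R * (K * B).
  exact.
elim=> [_|m IH mn].
  have -> : P 0%N = 0 by apply/rowP => i; rewrite !mxE.
  by rewrite addr0 subrr normr0 mul0r.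
pose i := Ordinal mn.
have PS t : P m + t *: evec R i = \row_j (if (j < m)%N then v ord0 j
                                     else if j == i then t else 0).
  apply/rowP => j; rewrite !mxE eqxx /=; case: ltnP => jm; last first.
    by rewrite add0r; case: eqP => _; rewrite ?mulr1 ?mulr0.
  have /negPf -> : j != i by rewrite -val_eqE /= ltn_eqF.
  by rewrite mulr0 addr0.
have PSm : P m.+1 = P m + v ord0 i *: evec R i.
  rewrite PS; apply/rowP => j; rewrite !mxE ltnS leq_eqVlt.
  case: ltnP => [_|jm]; first by rewrite orbT.
  rewrite orbF -(val_eqE j i) /=; case: eqP => [ji|//].
  by congr (v _ _); exact: val_inj.
have [z zv E] := mvt_line h (x + P m) (evec R i) (v ord0 i) (fun y => dh y i).
rewrite PSm addrA -(subrKA (h (x + P m))) (le_trans (ler_normD _ _)) //.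
rewrite -natr1 mulrDl mul1r [leRHS]addrC.
apply: lerD; last exact: (IH (ltnW mn)).
rewrite E normrM -addrA PS ler_pM // hB // => j; rewrite mxE.
case: ifP => // _; case: ifP => _; last by rewrite normr0 (le_trans _ (vK i)).
exact: le_trans (vK i).
Qed.

Lemma is_derive_dotv {R : realType} {n : nat} (a y v : 'rV[R]_n) :
  is_derive y v (dotv a) (dotv a v).
Proof.
by apply: (is_derive_quotient _ _ _ _ 0) => h; rewrite dotvDr dotvZr mulr0 addr0.
Qed.

Lemma dotv_grad {R : realType} {n : nat} (F : 'rV[R]_n -> R) (x : 'rV[R]_n) (i : 'I_n) :
  dotv (grad F x) (evec R i) = derive F x (evec R i).
Proof. by rewrite dotv_evec mxE. Qed.

(** The box estimate is used twice: on F minus its linear part, and on each partial derivative of F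
    to bound the gradient of that difference. *)
Lemma taylor1 {R : realType} {n : nat} (F : 'rV[R]_n -> R) (x v : 'rV[R]_n) (B K : R) :
  (forall y i, derivable F y (evec R i)) ->
  (forall y i j, derivable (fun y => derive F y (evec R i)) y (evec R j)) ->
  (forall y i j, `|hess F y i j| <= B) ->
  (forall i, `|v ord0 i| <= K) ->
  `|F (x + v) - F x - dotv (grad F x) v| <= n%:R * (K * (n%:R * (K * B))).
Proof.
move=> dF ddF HB vK.
have dh y i : is_derive y (evec R i) (F \- dotv (grad F x))
    (derive F y (evec R i) - derive F x (evec R i)).
  rewrite -(dotv_grad F x); apply: is_deriveB; last exact: is_derive_dotv.
  exact: derivableP.
have -> : F (x + v) - F x - dotv (grad F x) v =
    (F \- dotv (grad F x)) (x + v) - (F \- dotv (grad F x)) x.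
  by rewrite /= dotvDr; ring.
have dG y i : derivable (F \- dotv (grad F x)) y (evec R i) by case: (dh y i).
apply: (le_partials_box _ _ _ _ _ dG vK) => w i wK.
rewrite derive_val; apply: (le_partials_box (fun y => derive F y (evec R i))) => //.
by move=> w' j _; have := HB (x + w') i j; rewrite mxE.
Qed.

Lemma dotv_grad_le {R : realType} {n : nat} (F : 'rV[R]_n -> R) (x v : 'rV[R]_n) (B d c : R) :
  (forall y i, derivable F y (evec R i)) ->
  (forall y i j, derivable (fun y => derive F y (evec R i)) y (evec R j)) ->
  (forall y i j, `|hess F y i j| <= B) -> 0 < d ->
  (forall t, 0 < t < d -> F (x + t *: v) <= F x + t * c) ->
  dotv (grad F x) v <= c.
Proof.
move=> dF ddF HB d0 Fc; apply/ler_addgt0Pr => e e0.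
pose K := enorm v; pose C := n%:R * (K * (n%:R * (K * `|B|))).
have C0 : 0 <= C by rewrite !mulr_ge0 ?enorm_ge0.
(* The remainder is at most t^2 C, so after division by t it costs t C <= e. *)
pose t := Num.min (d / 2) (e / (C + 1)).
have t0 : 0 < t by rewrite lt_min !divr_gt0 //; lra.
have td : t < d by rewrite (le_lt_trans (y := d / 2)) ?ge_min ?lexx //; lra.
have tC : t * C <= e.
  have : t <= e / (C + 1) by rewrite ge_min lexx orbT.
  rewrite ler_pdivlMr; [nra | lra].
have HB' y i j : `|hess F y i j| <= `|B| by rewrite (le_trans (HB y i j)) ?ler_norm.
have vK i : `|(t *: v) ord0 i| <= t * K.
  by rewrite mxE normrM gtr0_norm // ler_wpM2l ?coord_le_enorm // ltW.
have := taylor1 F x (t *: v) `|B| (t * K) dF ddF HB' vK.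
have -> : n%:R * (t * K * (n%:R * (t * K * `|B|))) = t * (t * C) by rewrite /C; ring.
rewrite dotvZr ler_norml => /andP[h _].
have := Fc t; rewrite t0 td => /(_ isT) h2.
rewrite -(ler_pM2l t0); nra.
Qed.

(** * The regularized Newton step and stationarity *)

Lemma is_derive_sqr_enorm {R : realType} {n : nat} (a : R) (c y v : 'rV[R]_n) :
  is_derive y v (fun y => a * enorm (y - c) ^+ 2) (2 * a * dotv (y - c) v).
Proof.
apply: (is_derive_quotient _ _ _ _ (a * dotv v v)) => h.
rewrite !sqr_enorm addrAC; move: (y - c) => q.
by rewrite !(dotvDl, dotvDr, dotvZl, dotvZr) (dotvC v q); ring.
Qed.

Lemma derive_regularized {R : realType} {n : nat} (F : 'rV[R]_n -> R) (a : R)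
    (c y : 'rV[R]_n) (i : 'I_n) : derivable F y (evec R i) ->
  derive (fun y => F y + a * enorm (y - c) ^+ 2) y (evec R i) =
  derive F y (evec R i) + 2 * a * (y - c) ord0 i.
Proof.
move=> dF; have dQ := is_derive_sqr_enorm a c y (evec R i).
rewrite (deriveD (f := F) (g := fun y => a * enorm (y - c) ^+ 2)) //.
by rewrite [in LHS]derive_val dotv_evec.
Qed.

Lemma grad_regularized {R : realType} {n : nat} (F : 'rV[R]_n -> R) (a : R)
    (c : 'rV[R]_n) : (forall i, derivable F c (evec R i)) ->
  grad (fun y => F y + a * enorm (y - c) ^+ 2) c = grad F c.
Proof.
move=> dF; apply/rowP => i; rewrite !mxE derive_regularized //.
by rewrite subrr mxE mulr0 addr0.
Qed.

Lemma hess_regularized {R : realType} {n : nat} (F : 'rV[R]_n -> R) (a : R)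
    (c x : 'rV[R]_n) : (forall y i, derivable F y (evec R i)) ->
  (forall y i j, derivable (fun y => derive F y (evec R i)) y (evec R j)) ->
  hess (fun y => F y + a * enorm (y - c) ^+ 2) x = hess F x + (2 * a)%:M.
Proof.
move=> dF ddF; apply/matrixP => i j; rewrite !mxE.
under [X in derive X]eq_fun do rewrite derive_regularized //.
have dl : is_derive x (evec R j) (fun y : 'rV[R]_n => 2 * a * (y - c) ord0 i)
    ((2 * a) *+ (i == j)).
  apply: (is_derive_quotient _ _ _ _ 0) => h; rewrite !mxE eqxx /= mulr0 addr0.
  by rewrite -mulr_natr; ring.
by rewrite (deriveD (f := fun y => derive F y (evec R i))) // [X in _ + X]derive_val.
Qed.

(** Once H + 2a is known to be invertible, the Newton system can be read backwards: grad F = - (H +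
    2a) D, of norm at most (a + 2a) |D|. *)
Lemma enorm_grad_le_newton_dir {R : realType} {n : nat} (F : 'rV[R]_n -> R) (a : R)
    (x : 'rV[R]_n) :
  0 < a -> (forall y i, derivable F y (evec R i)) ->
  (forall y i j, derivable (fun y => derive F y (evec R i)) y (evec R j)) ->
  (forall z, enorm (z *m (hess F x)^T) <= a * enorm z) ->
  enorm (grad F x) <=
    3 * a * enorm (newton_dir (fun y => F y + a * enorm (y - x) ^+ 2) x).
Proof.
move=> a0 dF ddF HF.
set G := fun y => _; set D := newton_dir G x; set H := hess F x + (2 * a)%:M.
have zH z : z *m H^T = z *m (hess F x)^T + (2 * a) *: z.
  by rewrite linearD /= tr_scalar_mx mulmxDr mul_mx_scalar.
have Hu : H \in unitmx.
  (* A kernel vector z would satisfy 2a |z| = |H z| <= a |z|, hence z = 0. *)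
  rewrite -unitmx_tr unitmxE unitfE; apply/negP => /det0P[z z0 zH0].
  have := HF z; move: zH0; rewrite zH => /eqP; rewrite addr_eq0 => /eqP ->.
  rewrite enormN enormZ gtr0_norm; last lra.
  have [|zp] := leP (enorm z) 0.
    have := enorm_ge0 z => h1 h2.
    by move: z0; rewrite (enorm0_eq0 z) ?eqxx //; apply/le_anti; rewrite h1 h2.
  nra.
have -> : grad F x = - (D *m (hess F x)^T + (2 * a) *: D).
  rewrite -zH /D /newton_dir mulNmx opprK /G hess_regularized // -/H.
  by rewrite grad_regularized // -trmx_mul mulKVmx // trmxK.
rewrite enormN (le_trans (enormD _ _)) // enormZ gtr0_norm; last lra.
have := HF D; lra.
Qed.

(** * From small gradients to Clarke stationarity *)

Lemma clarke_subdiff0 {R : realType} {n : nat} (f : 'rV[R]_n -> R)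
    (xs : 'rV[R]_n) :
  (forall (v : 'rV[R]_n) (d c : R), 0 < d -> 0 < c ->
     exists (y : 'rV[R]_n) (t : R),
       [/\ enorm (y - xs) < d, 0 < t < d & f y - t * c < f (y + t *: v)]) ->
  clarke_subdiff f xs 0.
Proof.
move=> H v; rewrite (_ : dotv 0 v = 0); last first.
  by rewrite -(scale0r 0) dotvZl mul0r.
apply/ereal_infP => _ [d [d0 ->]]; set S := ereal_sup _.
rewrite leNgt; apply/negP => S0.
suff [c c0 Sc] : exists2 c : R, 0 < c & (S <= (- c)%:E)%E.
  have [y [t [yd /andP[t0 td] ft]]] := H v d c d0 c0.
  have : (((f (y + t *: v) - f y) / t)%:E <= S)%E.
    by apply: ereal_sup_ubound; exists y, t; rewrite t0 td.
  move=> /le_trans /(_ Sc); rewrite lee_fin ler_pdivrMr //; lra.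
(* The supremum may be -oo, where any c serves; 1 is taken. *)
move: S0; case: S => [r| |] //; last by exists 1; rewrite ?leNye.
by rewrite lte_fin => r0; exists (- r); rewrite ?opprK ?oppr_gt0.
Qed.

Lemma abs_hess_le {R : realType} {n : nat} (F : 'rV[R]_n -> R) (a : R) (x : 'rV[R]_n) i j :
  (forall z, enorm (z *m (hess F x)^T) <= a * enorm z) -> `|hess F x i j| <= a.
Proof.
move=> /(_ (evec R j)); rewrite enorm_evec mulr1; apply: le_trans.
have -> : hess F x i j = (evec R j *m (hess F x)^T) ord0 i.
  by rewrite /evec -rowE [RHS]mxE [RHS]mxE.
exact: coord_le_enorm.
Qed.

(** The dimension is positive because balls of R^0 have diameter 0. *)
Lemma diam_eball_gt0 {R : realType} {n : nat} (r : R) : 0 < r ->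
  0 < diam (eball r : set 'rV[R]_n.+1).
Proof.
move=> r0; apply: (lt_le_trans r0).
have E : enorm (r *: evec R (ord0 : 'I_n.+1)) = r.
  by rewrite enormZ enorm_evec mulr1 gtr0_norm.
by rewrite -[leLHS]E enorm_le_diam_eball ?E // ltW.
Qed.

Theorem theorem3 (R : realType) (n : nat) (f : 'rV[R]_n -> R) (L : R)
    (r : nat -> R) (eps : nat -> R)
    (x : nat -> 'rV[R]_n) (s : nat -> nat) (l : nat -> nat) :
  (* f is Lipschitz with constant L and bounded below *)
  (forall u v, `|f u - f v| <= L * enorm (u - v)) ->
  (exists c, forall u, c <= f u) ->
  (* radii r_s -> +0 *)
  (forall j, 0 < r j) -> r @ \oo --> 0 ->
  (* standing facts on Phi_s: C^2 with Hessian bound L_s = L / d(D_s) *)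
  (forall j, C2 (Phi f (@eball R n (r j)))) ->
  (forall j y z, enorm (z *m (hess (Phi f (@eball R n (r j))) y)^T)
                   <= L / diam (@eball R n (r j)) * enorm z) ->
  (* Phi_s bounded below uniformly in s, attaining infima *)
  (exists c, forall j y, c <= Phi f (@eball R n (r j)) y) ->
  (forall j, exists y0, forall y, Phi f (@eball R n (r j)) y0 <= Phi f (@eball R n (r j)) y) ->
  (* eps_k -> +0 *)
  (forall k, 0 < eps k) -> eps @ \oo --> 0 ->
  (* s(k) is changed monotonically, with d(D_s) decreasing to 0 *)
  {homo s : a b / (a <= b)%N} ->
  (forall M : nat, exists K : nat, forall k, (K <= k)%N -> (M <= s k)%N) ->
  (* the algorithm *)
  (forall k,
     let Ls := L / diam (@eball R n (r (s k))) in
     let Phit := fun y => Phi f (@eball R n (r (s k))) y + Ls * enorm (y - x k) ^+ 2 in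
     let Delta := newton_dir Phit (x k) in
     [/\ Phit (x k + 2 ^- (l k) *: Delta)
           <= Phit (x k) - 2 ^- (2 * l k) * (Ls / 2) * enorm Delta ^+ 2,
         x k.+1 = x k + 2 ^- (l k) *: Delta
       & 3 * enorm Delta / diam (@eball R n (r (s k))) < eps k]) ->
  forall xstar, seq_limit_point x xstar -> 0 \in clarke_subdiff f xstar.
Proof.
move=> fL _ r0 rcvg Phi_C2 Phi_hess _ _ _ epscvg _ s_unbounded algo xs xs_lim.
rewrite inE; apply: clarke_subdiff0 => v d c d0 c0.
(* In dimension 0 the diameter vanishes and L_s is a division by 0; but there y + t v = y. *)
case: n => [|n] in f x fL Phi_C2 Phi_hess algo xs xs_lim v *.
  exists xs, (d / 2); rewrite subrr enorm0 d0; split => //; first by apply/andP; split; lra.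
  rewrite (_ : xs + _ = xs); last by rewrite thinmx0 [RHS]thinmx0.
  have : 0 < d / 2 * c by rewrite mulr_gt0 //; lra.
  lra.
(* L_s must be positive for the Newton estimate; if L <= 0, the Lipschitz bound forbids any decrease
   of f. *)
have [L0|L0] := leP L 0.
  exists xs, (d / 2); rewrite subrr enorm0 d0; split => //; first by apply/andP; split; lra.
  have := fL (xs + (d / 2) *: v) xs; rewrite ler_norml => /andP[+ _].
  have : L * enorm (xs + (d / 2) *: v - xs) <= 0 by rewrite mulr_le0_ge0 ?enorm_ge0.
  have : 0 < d / 2 * c by rewrite mulr_gt0 //; lra.
  lra.
apply: contrapT => no_slope.
have f_decr t z : 0 < t < d -> enorm (z - xs) < d -> f (z + t *: v) <= f z + t * (- c).
  move=> td zd; rewrite leNgt; apply/negP => h; apply: no_slope.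
  by exists z, t; split => //; rewrite -mulrN.
(* With |x_k - x*| < d / 2, a radius below d / 8 leaves |x_k - x*| + 2 r < d. *)
have d8 : 0 < d / 8 by lra.
(* Chosen so that L eps_k (|v| + 1) < c; the added 1 covers v = 0. *)
have q0 : 0 < c / (L * (enorm v + 1)).
  by have := enorm_ge0 v => ?; rewrite divr_gt0 // mulr_gt0 //; lra.
have [N1 _ rN1] := (cvgrPdist_lt _ _).1 rcvg _ d8.
have [N2 _ epsN2] := (cvgrPdist_lt _ _).1 epscvg _ q0.
have [K sK] := s_unbounded N1.
have d2 : 0 < d / 2 by lra.
have [k [kN xkd]] := xs_lim _ d2 (maxn K N2).
move: kN; rewrite geq_max => /andP[/sK sk kN2].
have rk : r (s k) < d / 8.
  by have := rN1 _ sk; rewrite sub0r normrN => /(le_lt_trans (ler_norm _)).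
have epsk : eps k < c / (L * (enorm v + 1)).
  by have := epsN2 _ kN2; rewrite sub0r normrN => /(le_lt_trans (ler_norm _)).
have [_ _] := algo k.
move: (r0 (s k)) (Phi_C2 (s k)) (Phi_hess (s k)) rk; move: (r (s k)) => rho rho0 C2F HF rk.
set F := Phi f (eball rho) in C2F HF *; set Ls := L / _; set Delta := newton_dir _ _.
move=> Dk.
have diam0 := @diam_eball_gt0 R n rho rho0.
have Ls0 : 0 < Ls by rewrite divr_gt0.
have dF y i : derivable F y (evec R i) by case: (C2F i i).
have ddF y i j : derivable (fun y => derive F y (evec R i)) y (evec R j).
  by case: (C2F i j) => _ [].
have := dotv_grad_le F (x k) v Ls d (- c) dF ddF
          (fun y i j => abs_hess_le F Ls y i j (HF y)) d0.
have slope t : 0 < t < d -> F (x k + t *: v) <= F (x k) + t * (- c).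
  move=> td; apply: (Phi_eball_decr f L rho d _ xs) => //; first exact: ltW.
    by move=> z; exact: f_decr.
  lra.
move=> /(_ slope).
have := enorm_grad_le_newton_dir F Ls (x k) Ls0 dF ddF (HF (x k)).
rewrite -/Delta (_ : 3 * Ls * enorm Delta = L * (3 * enorm Delta / diam (eball rho : set 'rV[R]_n.+1))).
  2: by rewrite /Ls; field; rewrite gt_eqF.
have : L * (3 * enorm Delta / diam (eball rho : set 'rV[R]_n.+1)) <= L * eps k.
  by rewrite ler_pM2l // ltW.
have v0 := enorm_ge0 v.
move: epsk; rewrite ltr_pdivlMr; last by rewrite mulr_gt0 //; lra.
have := dotv_le (grad F (x k)) v; rewrite ler_norml => /andP[+ _].
have := enorm_ge0 (grad F (x k)).
set g := enorm (grad F (x k)); set w := enorm v in v0 *; set p := L * (_ / _).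
move=> g0 hdot hc hp hg hd.
(* By Cauchy-Schwarz c <= |grad| |v|, while |grad| |v| <= L eps_k |v| < c. *)
have : g * w <= L * eps k * w by rewrite ler_wpM2r //; lra.
have : 0 <= L * eps k by lra.
nra.
Qed.
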